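(* Let $\frac12<\alpha<1$ and let $\varepsilon\mapsto(\varphi(\varepsilon),\mu(\varepsilon))$, $\mathbb{R}_{\ge0}\to S$, be one of the global continuous curves of Whitham solutions extending the local bifurcation curves (described in the context). The alternative (i) $\|\varphi(\varepsilon)\|_{C^\alpha(\mathbb{S})}$ is unbounded as $\varepsilon\to\infty$ can happen only if $$\liminf_{\varepsilon\to\infty}\ \inf_{x\in\mathbb{R}}\left(\frac{\mu(\varepsilon)}{2}-\varphi(x;\varepsilon)\right)=0.$$ In particular, alternative (i) implies the alternative (ii) the pair $(\varphi(\varepsilon),\mu(\varepsilon))$ approaches the boundary of $U$ as $\varepsilon\to\infty$, i.e. $\liminf_{\varepsilon\to\infty}\operatorname{dist}\big((\varphi(\varepsilon),\mu(\varepsilon)),\partial U\big)=0$, with distance and boundary taken in $C^\alpha_{\mathrm{even}}(\mathbb{S})\times\mathbb{R}$.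
   Context: $\mathbb{S}$ is the unit circle; functions on $\mathbb{S}$ are identified with $2\pi$-periodic functions on $\mathbb{R}$. $C^\alpha_{\mathrm{even}}(\mathbb{S})$ is the Banach space of real-valued, even, $\alpha$-Hölder continuous functions on $\mathbb{S}$, with the norm of $C^\alpha(\mathbb{S})$. We write $\varphi(x;\varepsilon)$ for the value of $\varphi(\varepsilon)$ at $x$. The Whitham kernel $K\in L^1(\mathbb{R})$ is the inverse Fourier transform of $\xi\mapsto(\tanh(\xi)/\xi)^{1/2}$ (value $1$ at $\xi=0$), where the Fourier transform is $\int f(x)e^{-ix\xi}\,dx$. The operator $L_W f:=K*f$ acts on $f=\sum_{k\ge0}a_k\cos(kx)\in C^\alpha_{\mathrm{even}}(\mathbb{S})$ by $L_Wf=\sum_{k\ge 0}a_k(\tanh(k)/k)^{1/2}\cos(kx)$, the factor for $k=0$ being $1$. Set $F_W(\varphi,\mu):=\mu\varphi-L_W\varphi-\varphi^2$. A Whitham solution is a pair $(\varphi,\mu)$ with $F_W(\varphi,\mu)=0$. $U:=\{(\varphi,\mu)\in C^\alpha_{\mathrm{even}}(\mathbb{S})\times(0,1):\varphi<\mu/2\}$ and $S:=\{(\varphi,\mu)\in U: F_W(\varphi,\mu)=0\}$. For each integer $k\ge1$ there is a local analytic curve $\varepsilon\mapsto(\varphi(\varepsilon),\mu(\varepsilon))$ of nontrivial $2\pi/k$-periodic Whitham solutions with $(\varphi(0),\mu(0))=(0,\mu_k)$, $\mu_k=(\tanh(k)/k)^{1/2}$, and $\frac{d\varphi}{d\varepsilon}(0)=\cos(kx)$.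 These local curves extend to global continuous curves $\mathbb{R}_{\ge0}\to S$, the ones considered here. *)

(* Defs.v *)
From HB Require Import structures.
From mathcomp Require Import all_boot all_order all_algebra.
From mathcomp Require Import all_classical all_reals all_analysis.

Set Implicit Arguments.
Unset Strict Implicit.
Unset Printing Implicit Defensive.

Import Order.TTheory GRing.Theory Num.Theory.
Import numFieldNormedType.Exports.

Local Open Scope classical_set_scope.
Local Open Scope ring_scope.

(* The Banach space of real-valued even alpha-Hoelder functions on the unit
   circle; functions on the circle are 2pi-periodic functions on R. *)
Section holder_even.
Variables (R : realType) (alpha : R).

(* Boundedness is redundant when 0 < alpha, by periodicity; keeping it makes
   the norm below well behaved without any assumption on alpha. *)
Definition is_holder_even (f : R -> R) : Prop :=
  [/\ forall x, f (- x) = f x,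
      forall x, f (x + 2 * pi) = f x,
      exists M, forall x, `|f x| <= M &
      exists C, forall x y, `|f x - f y| <= C * `|x - y| `^ alpha].

Definition holder_even_pred : {pred R -> R} := mem [set f | is_holder_even f].

Lemma holder_even_submod_closed : submod_closed holder_even_pred.
Proof.
split.
  rewrite inE; split=> //; exists 0 => *; first by rewrite normr0.
  by rewrite subrr normr0 mul0r.
move=> a f g; rewrite !inE => -[fe fp [M fM] [C fC]] [ge gp [N gN] [D gD]].
split=> [x|x| |].
- by rewrite !fctE fe ge.
- by rewrite !fctE fp gp.
- exists (`|a| * M + N) => x; rewrite !fctE (le_trans (ler_normD _ _))//.
  by rewrite lerD// normrM ler_wpM2l.
- exists (`|a| * C + D) => x y; rewrite !fctE opprD addrACA -mulrBr.
  rewrite (le_trans (ler_normD _ _))// mulrDl lerD// normrM -mulrA.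
  by rewrite ler_wpM2l.
Qed.

HB.instance Definition _ :=
  GRing.isSubmodClosed.Build _ _ holder_even_pred holder_even_submod_closed.

Record holder_even := HolderEven {
  holder_even_fun :> R -> R ;
  _ : holder_even_fun \in holder_even_pred }.

HB.instance Definition _ := [isSub for holder_even_fun].
HB.instance Definition _ := [Choice of holder_even by <:].
HB.instance Definition _ := [SubChoice_isSubLmodule of holder_even by <:].

Implicit Types f g : holder_even.

Definition holder_sup f : R := sup [set `|f x| | x in setT].

Definition holder_seminorm f : R :=
  sup [set `|f p.1 - f p.2| / `|p.1 - p.2| `^ alpha
      | p in [set p : R * R | p.1 != p.2]].

Definition holder_norm f : R := holder_sup f + holder_seminorm f.

Lemma holder_evenP f : is_holder_even f.
Proof. by have := valP f; rewrite inE. Qed.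

Lemma holder_sup_ub f x : `|f x| <= holder_sup f.
Proof.
apply: ub_le_sup; last by exists x.
by case: (holder_evenP f) => _ _ [M fM] _; exists M => _ [y _ <-].
Qed.

Lemma holder_seminorm_ub f x y : x != y ->
  `|f x - f y| / `|x - y| `^ alpha <= holder_seminorm f.
Proof.
move=> xy; apply: ub_le_sup; last by exists (x, y).
case: (holder_evenP f) => _ _ _ [C fC]; exists C => _ [[u v]/= uv <-].
by rewrite ler_pdivrMr// powR_gt0// normr_gt0 subr_eq0.
Qed.

Lemma holder_sup_le f M : (forall x, `|f x| <= M) -> holder_sup f <= M.
Proof.
move=> fM; apply: ge_sup; first by exists `|f 0|; exists 0.
by move=> _ [x _ <-].
Qed.

Lemma holder_seminorm_le f M :
  (forall x y, x != y -> `|f x - f y| / `|x - y| `^ alpha <= M) ->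
  holder_seminorm f <= M.
Proof.
move=> fM; apply: ge_sup; last by move=> _ [[x y]/= xy <-]; exact: fM.
by eexists; exists (1, 0) => //=; exact: oner_neq0.
Qed.

Lemma holder_sup_ge0 f : 0 <= holder_sup f.
Proof. exact: le_trans (normr_ge0 _) (holder_sup_ub f 0). Qed.

Lemma holder_seminorm_ge0 f : 0 <= holder_seminorm f.
Proof.
apply: le_trans (@holder_seminorm_ub f 1 0 (oner_neq0 _)).
by rewrite divr_ge0// powR_ge0.
Qed.

Lemma holder_normD f g : holder_norm (f + g) <= holder_norm f + holder_norm g.
Proof.
rewrite /holder_norm addrACA lerD//.
  apply: holder_sup_le => x.
  by rewrite (le_trans (ler_normD _ _))// lerD// holder_sup_ub.
apply: holder_seminorm_le => x y xy.
apply: le_trans (lerD (holder_seminorm_ub f xy) (holder_seminorm_ub g xy)).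
rewrite -mulrDl ler_wpM2r ?invr_ge0 ?powR_ge0//.
by rewrite opprD addrACA ler_normD.
Qed.

Lemma holder_normZ_le (a : R) f : holder_norm (a *: f) <= `|a| * holder_norm f.
Proof.
rewrite /holder_norm mulrDr lerD//.
  by apply: holder_sup_le => x; rewrite normrM ler_wpM2l// holder_sup_ub.
apply: holder_seminorm_le => x y xy.
rewrite -mulrBr normrM -mulrA ler_wpM2l//.
exact: holder_seminorm_ub.
Qed.

Lemma holder_normZ (a : R) f : holder_norm (a *: f) = `|a| * holder_norm f.
Proof.
apply/eqP; rewrite eq_le holder_normZ_le/=.
have [->|a0] := eqVneq a 0.
  by rewrite normr0 mul0r addr_ge0 ?holder_sup_ge0 ?holder_seminorm_ge0.
rewrite -ler_pdivlMl ?normr_gt0// -normfV.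
by have := holder_normZ_le a^-1 (a *: f); rewrite scalerA mulVf// scale1r.
Qed.

Lemma holder_norm0_eq0 f : holder_norm f = 0 -> f = 0.
Proof.
move=> f0; apply/val_inj/funext => x; apply/eqP; rewrite -normr_le0.
apply: le_trans (holder_sup_ub f x) _.
by rewrite -f0 lerDl holder_seminorm_ge0.
Qed.

HB.instance Definition _ := Lmodule_isNormed.Build R holder_even
  holder_normD holder_normZ holder_norm0_eq0.

End holder_even.

Section whitham.
Variable R : realType.
Local Notation leb := (@lebesgue_measure R).

Definition tanh (x : R) : R :=
  (expR x - expR (- x)) / (expR x + expR (- x)).

Definition whitham_symbol (xi : R) : R :=
  if xi == 0 then 1 else Num.sqrt (tanh xi / xi).

(* K is integrable and its Fourier transform, the integral of
   K(x) exp(-i x xi), is the (real) symbol: the two equations are the real part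
   and minus the imaginary part. This determines K almost everywhere. *)
Definition is_whitham_kernel (K : R -> R) : Prop :=
  [/\ leb.-integrable setT (EFin \o K),
      forall xi : R, (\int[leb]_x (K x * cos (x * xi)))%R = whitham_symbol xi &
      forall xi : R, (\int[leb]_x (K x * sin (x * xi)))%R = 0].

Definition whitham_op (K f : R -> R) (x : R) : R :=
  (\int[leb]_y (K (x - y) * f y))%R.

Definition whitham_F (K f : R -> R) (mu x : R) : R :=
  mu * f x - whitham_op K f x - f x ^+ 2.

Definition whitham_solution (K f : R -> R) (mu : R) : Prop :=
  forall x, whitham_F K f mu x = 0.

Definition whitham_U (alpha : R) : set (holder_even alpha * R) :=
  [set z : holder_even alpha * R | 0 < z.2 < 1 /\ forall x, z.1 x < z.2 / 2].

Definition whitham_S (K : R -> R) (alpha : R) : set (holder_even alpha * R) :=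
  [set z : holder_even alpha * R | whitham_U z /\ whitham_solution K z.1 z.2].

Definition boundary (T : topologicalType) (A : set T) : set T :=
  closure A `\` interior A.

Definition analytic_at (V : normedModType R) (f : R -> V) (t : R) : Prop :=
  exists a : nat -> V,
    \forall s \near t, series (fun n => (s - t) ^+ n *: a n) @ \oo --> f s.

Definition local_bifurcation_curve (K : R -> R) (alpha : R) (k : nat)
    (delta : R) (phi : R -> holder_even alpha) (mu : R -> R) : Prop :=
  [/\ forall e : R, `|e| < delta -> analytic_at (fun s => (phi s, mu s)) e,
      forall e : R, `|e| < delta -> whitham_solution K (phi e) (mu e) /\
        forall x : R, phi e (x + 2 * pi / k%:R) = phi e x,
      forall e : R, 0 < `|e| < delta -> phi e != 0,
      phi 0 = 0 /\ mu 0 = whitham_symbol k%:R &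
      derivable phi 0 1 /\ forall x, 'D_1 phi 0 x = cos (k%:R * x)].

(* Curves on R are used to represent curves on [0, +oo[; the values at negative
   parameters are irrelevant. *)
Definition global_bifurcation_curve (K : R -> R) (alpha : R)
    (phi : R -> holder_even alpha) (mu : R -> R) : Prop :=
  [/\ {within `[0, +oo[, continuous (fun e : R => (phi e, mu e))},
      forall e : R, 0 <= e -> whitham_S K (phi e, mu e) &
      exists (k : nat) (delta : R) (phi_loc : R -> holder_even alpha)
             (mu_loc : R -> R),
        [/\ (0 < k)%N, 0 < delta,
            local_bifurcation_curve K k delta phi_loc mu_loc &
            forall e : R, 0 <= e < delta -> phi e = phi_loc e /\ mu e = mu_loc e]].

End whitham.

Arguments whitham_U {R} alpha _.
Arguments whitham_S {R} K alpha _.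

(* Main.v *)
Require Import Defs.
From mathcomp Require Import all_boot all_order all_algebra.
From mathcomp Require Import all_classical all_reals all_analysis.
From mathcomp Require Import measurable_realfun ring lra.

Set Implicit Arguments.
Unset Strict Implicit.
Unset Printing Implicit Defensive.

Import Order.TTheory GRing.Theory Num.Theory.
Import numFieldNormedType.Exports.
Local Open Scope classical_set_scope.
Local Open Scope ring_scope.

(** If the gap [mu e / 2 - phi e x] stays above some [delta > 0] for all large
    [e], then the Hoelder norm of [phi e] stays bounded, which is the
    contrapositive of the first claim. The equation
    [f ^+ 2 = mu f - L f], with [L] the convolution by [K], first gives a bound
    on the supremum: [sup|f| <= 1 + ||K||_1] ([whitham_solution_sup_bound]).
    Subtracting the equation at two points gives
    [(f x - f y) (mu - f x - f y) = L f x - L f y],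
    where the second factor is at least [2 delta]; so the Hoelder seminorm of
    [f] is at most [1 / (2 delta)] times that of [L f].

    It remains to see that [L] gains regularity: for each [eta > 0] there is a
    [C], independent of [f], such that the seminorm of [L f] is at most [eta]
    times that of [f] plus [C sup|f|] ([whitham_op_smoothing]). With
    [eta = delta] the first term is absorbed, and the seminorm of [f] is at
    most [C sup|f| / delta] ([whitham_solution_norm_bound]). The gain comes
    from the integrability of [K]. Convolution by a step function [s] turns a
    bounded function into a Lipschitz one, because translating an interval by
    [h] changes its indicator on a set of length at most [2 h]; convolution by
    [K - s] multiplies the Hoelder seminorm by at most [||K - s||_1]; and step
    functions are dense in L1 ([step_fun_dense]).

    For the second claim, raising [f] by the constant [inf (mu / 2 - f)] gives
    a function that touches [mu / 2], hence a boundary point of [U] at distance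
    at most this infimum ([edist_boundary_whitham_U]). *)

(** * Reflections of the real line preserve Lebesgue measure *)

Section reflection.
Context {R : realType}.
Local Notation leb := (@lebesgue_measure R).
Implicit Types (F : R -> R) (x : R).

(** The carrier is given as [measurableTypeR R], on which Lebesgue measure is
    defined, so that the pushforward of Lebesgue measure typechecks. *)
Definition point_reflection x : measurableTypeR R -> measurableTypeR R :=
  fun y => x - y.

Lemma measurable_point_reflection x : measurable_fun setT (point_reflection x).
Proof. exact: measurable_funB. Qed.

Lemma lebesgue_measure_reflect x (A : set R) : measurable A ->
  pushforward leb (point_reflection x) A = leb A.
Proof.
move=> mA; have mr := measurable_point_reflection x.
apply/esym/lebesgue_measure_unique => //= _ [[a b]] _ <-.
rewrite /pushforward.
have -> : point_reflection x @^-1` `]a, b]%classic = `[x - b, x - a[%classic.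
  by apply/seteqP; split => y; rewrite /point_reflection /= !in_itv /=
    => /andP[h1 h2]; apply/andP; split; lra.
rewrite !lebesgue_measure_itv/= !lte_fin ltrD2l ltrN2.
by case: ifP => // _; rewrite -!EFinB; congr (_%:E); ring.
Qed.

Lemma integrable_reflect F x : leb.-integrable setT (EFin \o F) ->
  leb.-integrable setT (EFin \o (fun y => F (x - y))).
Proof.
move=> iF; have mr := measurable_point_reflection x.
have mF : measurable_fun setT (EFin \o F) by case/integrableP: iF.
apply/integrableP; split; first exact: (measurableT_comp mF mr).
have /integrableP[_] := iF.
congr (_ < _)%E.
rewrite -(@eq_measure_integral _ _ _ setT _
  (pushforward leb (point_reflection x))); last first.
  by move=> A mA _; exact: lebesgue_measure_reflect.
rewrite ge0_integral_pushforward//; first exact: measurableT_comp.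
Qed.

Lemma Rintegral_reflect F x : leb.-integrable setT (EFin \o F) ->
  (\int[leb]_y F (x - y))%R = (\int[leb]_y F y)%R.
Proof.
move=> iF; have mr := measurable_point_reflection x.
have mF : measurable_fun setT (EFin \o F) by case/integrableP: iF.
rewrite /Rintegral; congr fine; apply/esym.
rewrite -(@eq_measure_integral _ _ _ setT _
  (pushforward leb (point_reflection x))); last first.
  by move=> A mA _; exact: lebesgue_measure_reflect.
rewrite (@integral_pushforward _ _ _ _ _ (point_reflection x) mr leb setT
  (EFin \o F) mF) //.
exact: integrable_reflect.
Qed.

End reflection.

(** * Convolution by an integrable kernel *)

Section convolution.
Context {R : realType}.
Local Notation leb := (@lebesgue_measure R).
Implicit Types (K G f : R -> R) (M x : R).

Definition L1norm K : R := (\int[leb]_y `|K y|)%R.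

Lemma L1norm_ge0 K : 0 <= L1norm K.
Proof. exact: Rintegral_ge0. Qed.

Lemma integrable_mul_bounded K f M : leb.-integrable setT (EFin \o K) ->
  measurable_fun setT f -> (forall y, `|f y| <= M) ->
  leb.-integrable setT (EFin \o (fun y => K y * f y)).
Proof.
move=> iK mf fM.
rewrite (_ : _ \o _ = (EFin \o K) \* (EFin \o f))%E; last first.
  by apply/funext => y; rewrite /= EFinM.
apply: integrableMl => //; exists M; split; first exact: num_real.
by move=> N MN y _ /=; exact: le_trans (fM y) (ltW MN).
Qed.

Lemma le_normr_Rintegral_mul K f M : leb.-integrable setT (EFin \o K) ->
  measurable_fun setT f -> (forall y, `|f y| <= M) ->
  `|(\int[leb]_y (K y * f y))%R| <= L1norm K * M.
Proof.
move=> iK mf fM; have iKf := integrable_mul_bounded iK mf fM.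
have iK' := integrable_norm iK.
apply: (le_trans (le_normr_Rintegral _ iKf)) => //.
rewrite -RintegralZr//; apply: le_Rintegral => //.
- exact: integrable_norm iKf.
- rewrite (_ : _ \o _ = (fun y => M%:E * (EFin \o (fun z => `|K z|%R)) y)%E).
    exact: integrableZl.
  by apply/funext => y; rewrite /= -EFinM mulrC.
- by move=> y _; rewrite normrM ler_wpM2l.
Qed.

Lemma measurable_fun_reflect f x : measurable_fun setT f ->
  measurable_fun setT (fun y : R => f (x - y)).
Proof.
by move=> mf; exact: (measurableT_comp mf (measurable_point_reflection x)).
Qed.

(** Once the translation is moved from the kernel to [f], increments of the
    convolution are convolutions of increments of [f]. *)
Lemma whitham_op_reflect K f M x : leb.-integrable setT (EFin \o K) ->
  measurable_fun setT f -> (forall y, `|f y| <= M) ->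
  whitham_op K f x = (\int[leb]_y (K y * f (x - y)))%R.
Proof.
move=> iK mf fM.
rewrite -(@Rintegral_reflect _ (fun y => K y * f (x - y)) x).
  by apply: eq_Rintegral => y _; rewrite subKr.
by apply: (@integrable_mul_bounded _ _ M) => //; exact: measurable_fun_reflect.
Qed.

Lemma whitham_op_bound K f M x : leb.-integrable setT (EFin \o K) ->
  measurable_fun setT f -> (forall y, `|f y| <= M) ->
  `|whitham_op K f x| <= L1norm K * M.
Proof.
move=> iK mf fM; rewrite (@whitham_op_reflect _ _ M)//.
by apply: le_normr_Rintegral_mul => //; exact: measurable_fun_reflect.
Qed.

Lemma whitham_op_diff_bound K f M B x x' : leb.-integrable setT (EFin \o K) ->
  measurable_fun setT f -> (forall y, `|f y| <= M) ->
  (forall y, `|f (x - y) - f (x' - y)| <= B) ->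
  `|whitham_op K f x - whitham_op K f x'| <= L1norm K * B.
Proof.
move=> iK mf fM fB; rewrite !(@whitham_op_reflect _ _ M)//.
have mr z := measurable_fun_reflect z mf.
rewrite -RintegralB//; try exact: (@integrable_mul_bounded _ _ M).
under eq_Rintegral do rewrite -mulrBr.
by apply: le_normr_Rintegral_mul => //; exact: measurable_funB.
Qed.

(** The form [c * K + G] is that of the constructor of step functions. *)
Lemma whitham_op_linear K G f M c x :
  leb.-integrable setT (EFin \o K) -> leb.-integrable setT (EFin \o G) ->
  measurable_fun setT f -> (forall y, `|f y| <= M) ->
  whitham_op (fun t => c * K t + G t) f x =
  c * whitham_op K f x + whitham_op G f x.
Proof.
move=> iK iG mf fM.
have iK' := integrable_mul_bounded (integrable_reflect x iK) mf fM.
have iG' := integrable_mul_bounded (integrable_reflect x iG) mf fM.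
rewrite /whitham_op -RintegralZl// -RintegralD//.
  by apply: eq_Rintegral => y _; rewrite mulrDl mulrA.
rewrite (_ : _ \o _ =
    (fun y => c%:E * (EFin \o (fun y => K (x - y)%R * f y)%R) y)%E).
  exact: integrableZl.
by apply/funext => y; rewrite /= -EFinM.
Qed.

End convolution.

(** * Density of step functions in L1 *)

Section step_functions.
Context {R : realType}.
Local Notation leb := (@lebesgue_measure R).
Implicit Types (g s K : R -> R).

(** Half-open intervals can be glued without overlap; an inductive predicate
    lets properties stable under linear combinations be proved by induction. *)
Inductive step_fun : (R -> R) -> Prop :=
| step_fun0 : step_fun (fun=> 0)
| step_funD c a b s : step_fun s ->
    step_fun (fun t => c * \1_(`]a, b]%classic) t + s t).

Lemma integrable_indic_oc (a b : R) :
  leb.-integrable setT (EFin \o \1_(`]a, b]%classic)).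
Proof. exact: (integrable_indic_itv a b false false). Qed.

Lemma integrable_linear c K s : leb.-integrable setT (EFin \o K) ->
  leb.-integrable setT (EFin \o s) ->
  leb.-integrable setT (EFin \o (fun t => c * K t + s t)).
Proof.
move=> iK is_.
rewrite (_ : _ \o _ =
    ((fun t => c%:E * (EFin \o K) t) \+ (EFin \o s))%E); last first.
  by apply/funext => t; rewrite /= -EFinM -EFinD.
by apply: integrableD => //; exact: integrableZl.
Qed.

Lemma step_fun_integrable s : step_fun s -> leb.-integrable setT (EFin \o s).
Proof.
elim=> [|c a b {}s _ IH]; first exact: integrable0.
by apply: integrable_linear => //; exact: integrable_indic_oc.
Qed.

(** Heine-Cantor: compactness of the segment, in the form of near coverings,
    makes the local moduli of continuity uniform. *)
Lemma uniform_continuity_segment g (a b eps : R) : continuous g -> 0 < eps ->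
  exists2 d : R, 0 < d &
    forall x y : R, x \in `[a, b] -> `|x - y| < d -> `|g x - g y| < eps.
Proof.
move=> cg e0; have /compact_near_coveringP cab := @segment_compact R a b.
pose P (d x : R) := forall y, `|x - y| < d -> `|g x - g y| < eps.
have := cab R (0^'+) P _ _; case.
  move=> x _; have /cvgrPdist_lt/(_ (eps / 2)) := cg x.
  rewrite divr_gt0// => /(_ isT)[r /= r0 gr].
  exists (ball x (r / 2), [set d | d < r / 2]) => /=.
    split; first by apply: nbhsx_ballx; rewrite divr_gt0.
    by apply: nbhs_right_lt; rewrite divr_gt0.
  move=> [y d] /= [+ dr] t ytd; rewrite /ball /= => xy.
  have gy : `|g x - g y| < eps / 2 by apply: gr => /=; lra.
  have gt : `|g x - g t| < eps / 2.
    apply: gr => /=; rewrite (le_lt_trans (ler_distD y _ _))//; lra.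
  by rewrite (le_lt_trans (ler_distD (g x) _ _))// (distrC (g y)); lra.
move=> e /= e_gt0 Pe; exists (e / 2); first by rewrite divr_gt0.
move=> x y xab; apply: (Pe (e / 2)) => //=; last by rewrite divr_gt0.
rewrite sub0r normrN gtr0_norm ?divr_gt0//; lra.
Qed.

(** The interval is cut into equal pieces shorter than a modulus of uniform
    continuity of [g], and [g] is replaced by its value at the right end of
    each piece. Multiplying the error bound by the indicator makes the step
    function vanish outside the interval. *)
Lemma continuous_step_approx g (a b eps : R) :
  a <= b -> continuous g -> 0 < eps ->
  exists2 s, step_fun s &
    forall t, `|g t * \1_(`]a, b]%classic) t - s t|
      <= eps * \1_(`]a, b]%classic) t.
Proof.
move=> ab cg e0; have [d d0 gd] := uniform_continuity_segment a b cg e0.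
pose N := (Num.truncn ((b - a) / d)).+1.
pose h := (b - a) / N%:R.
have N0 : 0 < N%:R :> R by rewrite ltr0n.
have hd : h < d.
  by rewrite /h ltr_pdivrMr// mulrC -ltr_pdivrMr// /N truncnS_gt.
have h0 : 0 <= h by rewrite divr_ge0// ?subr_ge0// ltW.
have hN : a + N%:R * h = b by rewrite /h mulrC divfK ?gt_eqF// addrC subrK.
suff: forall m, (m <= N)%N -> exists2 s, step_fun s &
    forall t, `|g t * \1_(`]a, a + m%:R * h]%classic) t - s t|
      <= eps * \1_(`]a, a + m%:R * h]%classic) t.
  by move=> /(_ _ (leqnn _)); rewrite hN.
elim=> [_|m IH mN].
  exists (fun=> 0); first exact: step_fun0.
  move=> t; rewrite mul0r addr0 set_itvoc0 indic0.
  by rewrite mulr0 mulr0 subr0 normr0.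
have [s ss gs] := IH (ltnW mN).
pose u := a + m%:R * h; pose v := a + m.+1%:R * h.
exists (fun t => g v * \1_(`]u, v]%classic) t + s t); first exact: step_funD.
have au : a <= u by rewrite /u lerDl mulr_ge0.
have uv : v = u + h by rewrite /u /v -natr1; ring.
have vb : v <= b.
  by rewrite -hN /v lerD2l ler_wpM2r// ler_nat.
move=> t; have := gs t; rewrite -/u -/v !indicE !mem_setE !in_itv /=.
have [ta|ta] := leP t a.
  have -> : (u < t) = false by apply/negbTE; rewrite -leNgt; lra.
  by rewrite /= !mulr0 !add0r.
have [tu|tu] := leP t u.
  have -> : (t <= v) by lra.
  by rewrite /= mulr0 !add0r.
have [tv|tv] := leP t v; rewrite /= ?mulr0 ?add0r ?sub0r ?mulr1 => H; last lra.
have s0 : s t = 0 by apply/eqP; rewrite -normr_le0; move: H; rewrite normrN.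
rewrite s0 addr0 ltW// distrC gd ?in_itv//=; first by apply/andP; split; lra.
by rewrite ger0_norm; lra.
Qed.

Lemma EFin_L1norm K : leb.-integrable setT (EFin \o K) ->
  (L1norm K)%:E = (\int[leb]_y `|K y|%:E)%E.
Proof.
move=> /integrable_norm iK; rewrite /L1norm /Rintegral fineK//.
exact: (integrable_fin_num _ iK).
Qed.

Lemma integrable_diff K g : leb.-integrable setT (EFin \o K) ->
  leb.-integrable setT (EFin \o g) ->
  leb.-integrable setT (EFin \o (fun t => K t - g t)).
Proof. by move=> iK ig; exact: (integrableB _ iK ig). Qed.

Lemma L1norm_triangle K g s : leb.-integrable setT (EFin \o K) ->
  leb.-integrable setT (EFin \o g) -> leb.-integrable setT (EFin \o s) ->
  L1norm (fun t => K t - s t) <=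
    L1norm (fun t => K t - g t) + L1norm (fun t => g t - s t).
Proof.
move=> iK ig is_.
have iKs := integrable_norm (integrable_diff iK is_).
have iKg := integrable_norm (integrable_diff iK ig).
have igs := integrable_norm (integrable_diff ig is_).
rewrite /L1norm -RintegralD//; apply: le_Rintegral => //.
  exact: (integrableD _ iKg igs).
by move=> t _; exact: ler_distD.
Qed.

Lemma integrable_mul_indic K (A : set R) : measurable A ->
  leb.-integrable setT (EFin \o K) ->
  leb.-integrable setT (EFin \o (fun t => K t * \1_A t)).
Proof.
move=> mA iK; apply: (@integrable_mul_bounded _ _ _ 1) => //.
by move=> y; rewrite indicE; case: (y \in A); rewrite /= ?normr1 ?normr0.
Qed.

(** Dominated convergence: the truncations converge pointwise to [K] and are
    dominated by [`|K|]. *)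
Lemma L1_truncation K (eta : R) : leb.-integrable setT (EFin \o K) -> 0 < eta ->
  exists n : nat, L1norm (fun t => K t - K t * \1_(`]- n%:R, n%:R]%classic) t)
    < eta.
Proof.
move=> iK eta0; have /integrableP[mK _] := iK.
pose A (n : nat) := `]- n%:R, n%:R]%classic : set R.
have iKA n : leb.-integrable setT (EFin \o (fun t => K t * \1_(A n) t)).
  by apply: integrable_mul_indic => //; exact: measurable_itv.
have [] := @dominated_convergence _ _ _ leb setT measurableT
    (fun n => EFin \o (fun t => K t * \1_(A n) t)) (EFin \o K)
    (EFin \o (fun t => `|K t|)).
- by move=> n; have /integrableP[] := iKA n.
- by [].
- apply: aeW => t _; apply: cvg_near_cst.
  near=> n; rewrite /= indicE mem_set ?mulr1// /A /= in_itv /=.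
  have : `|t| < n%:R by near: n; exact: nbhs_infty_gtr.
  by rewrite ltr_norml => /andP[-> /ltW ->].
- exact: integrable_norm.
- apply: aeW => t n _; rewrite /= lee_fin normrM indicE.
  by case: (_ \in _); rewrite /= ?normr1 ?mulr1// normr0 mulr0.
move=> _ + _ => /fine_cvgP[_ /cvgrPdist_lt/(_ _ eta0)[n _ /(_ n (leqnn _))]].
rewrite /= sub0r normrN => H; exists n; apply: le_lt_trans H.
have iKn := integrable_diff iK (iKA n).
rewrite -lee_fin EFin_L1norm//.
have -> : (\int[leb]_x `|(K x * \1_(A n) x)%:E - (K x)%:E|)%E =
    (\int[leb]_y `|K y - K y * \1_(A n) y|%:E)%E.
  by apply: eq_integral => t _; rewrite -EFinB /= distrC.
by rewrite -EFin_L1norm// lee_fin ler_norm.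
Unshelve. all: by end_near. Qed.

(** One third of [eta] is spent on each of three approximations: truncation to
    a bounded interval, a continuous function on this interval, and a step
    function uniformly close to the continuous one. *)
Lemma step_fun_dense K (eta : R) :
  leb.-integrable setT (EFin \o K) -> 0 < eta ->
  exists2 s, step_fun s & L1norm (fun t => K t - s t) <= eta.
Proof.
move=> iK eta0; have eta3 : 0 < eta / 3 by rewrite divr_gt0.
have [n Kn] := L1_truncation iK eta3.
set A := `]- n%:R, n%:R]%classic in Kn.
have mA : measurable A by exact: measurable_itv.
have lA : leb A = (n%:R *+ 2)%:E.
  rewrite /A lebesgue_measure_itv /= lte_fin; case: ifPn => [_|].
    by rewrite -EFinB opprK -mulr2n.
  rewrite -leNgt => nn; have : (n%:R : R) <= 0.
    have : (0 : R) <= n%:R by []. lra.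
  by rewrite lern0 => /eqP ->; rewrite mul0rn.
have iKE : leb.-integrable A (EFin \o K).
  by apply: (integrableS _ _ _ iK) => //; exact: measurable_itv.
have [|g_ [cg ig]] := approximation_continuous_integrable mA _ iKE.
  by suff : (leb A < +oo)%E by []; rewrite lA ltry.
move=> /fine_cvgP[fing /cvgrPdist_lt/(_ _ eta3)] cvg.
near \oo => m.
have Kg : (\int[leb]_(z in A) `|(K z - g_ m z)%:E| < (eta / 3)%:E)%E.
  rewrite -[X in (X < _)%E]fineK; last by near: m.
  rewrite lte_fin; apply: (le_lt_trans (ler_norm _)).
  rewrite -normrN -sub0r; near: m; exact: cvg.
set g := g_ m in Kg.
(* The uniform error is integrated over an interval of length [2 n]; adding
   [1] keeps the denominator positive when [n = 0]. *)
have eps0 : 0 < eta / 3 / (n%:R *+ 2 + 1).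
  by rewrite divr_gt0// ltr_pwDr// mulrn_wge0.
have [|s ss gs] := continuous_step_approx (a := - n%:R) (b := n%:R) _ (cg m)
  eps0.
  by have : (0 : R) <= n%:R by []; lra.
exists s => //.
have igA : leb.-integrable setT (EFin \o (fun t => g t * \1_A t)).
  have -> : EFin \o (fun t => g t * \1_A t) = (EFin \o g) \_ A.
    apply/funext => t; rewrite /= patchE indicE; case: ifP => _ /=.
      by rewrite mulr1.
    by rewrite mulr0.
  by apply/integrable_restrict => //; rewrite setTI; exact: ig.
have iKA := integrable_mul_indic mA iK.
have is_ := step_fun_integrable ss.
apply: (le_trans (L1norm_triangle iK iKA is_)).
have := L1norm_triangle iKA igA is_.
suff : L1norm (fun t => K t * \1_A t - g t * \1_A t) <= eta / 3 /\
       L1norm (fun t => g t * \1_A t - s t) <= eta / 3 by lra.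
split.
  rewrite -lee_fin (EFin_L1norm (integrable_diff iKA igA)).
  apply: le_trans (ltW Kg); rewrite [leRHS]integral_mkcond.
  rewrite le_eqVlt; apply/orP; left; apply/eqP/eq_integral => t _.
  rewrite -mulrBl patchE normrM indicE; case: ifP => _ /=.
    by rewrite normr1 mulr1.
  by rewrite normr0 mulr0.
have : L1norm (fun t => g t * \1_A t - s t) <=
    (\int[leb]_t (eta / 3 / (n%:R *+ 2 + 1) * \1_A t))%R.
  apply: le_Rintegral => //.
  - exact: integrable_norm (integrable_diff igA is_).
  - have := integrable_linear (eta / 3 / (n%:R *+ 2 + 1))
      (integrable_indic_oc (- n%:R) n%:R) (integrable0 leb setT).
    by apply: eq_integrable => // t _; rewrite /= addr0.
move=> /le_trans; apply.
rewrite RintegralZl//; last exact: integrable_indic_oc.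
have -> : (\int[leb]_t \1_A t)%R = n%:R *+ 2.
  by rewrite /Rintegral integral_indic// setIT; apply: (congr1 fine lA).
have n0 : (0 : R) <= n%:R *+ 2 by rewrite mulrn_wge0.
rewrite -mulrA ler_piMr ?(ltW eta3)// mulrC ler_pdivrMr ?mul1r; lra.
Unshelve. all: by end_near. Qed.

End step_functions.

(** * Convolution gains regularity *)

Section smoothing.
Context {R : realType}.
Local Notation leb := (@lebesgue_measure R).
Implicit Types (f s K : R -> R) (M x : R).

(** The two indicators of [y] can differ only if one of the end points [a], [b]
    lies between [x - y] and [x' - y], that is, if [y] is in
    [[x - a, x' - a]] or in [[x - b, x' - b]]. *)
Lemma L1norm_indic_shift (a b x x' : R) : x <= x' ->
  L1norm (fun y => \1_(`]a, b]%classic) (x - y) - \1_(`]a, b]%classic) (x' - y))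
    <= 2 * (x' - x).
Proof.
move=> xx'.
have iI z : leb.-integrable setT (EFin \o \1_(`[x - z, x' - z]%classic)).
  exact: (integrable_indic_itv (x - z) (x' - z) true false).
have lI z : (\int[leb]_y \1_(`[x - z, x' - z]%classic) y)%R = x' - x.
  rewrite /Rintegral integral_indic// setIT.
  transitivity (fine (leb `[x - z, x' - z]%classic)) => //.
  rewrite lebesgue_measure_itv /= lte_fin; case: ifPn => [_|].
    by rewrite -EFinB /=; ring.
  by rewrite -leNgt /=; lra.
have iJ z := integrable_reflect z (integrable_indic_oc a b).
have -> : 2 * (x' - x) = (\int[leb]_y (\1_(`[x - a, x' - a]%classic) y +
    \1_(`[x - b, x' - b]%classic) y))%R by rewrite RintegralD// !lI; ring.
apply: le_Rintegral => //.
- exact: integrable_norm (integrable_diff (iJ x) (iJ x')).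
- exact: (integrableD _ (iI a) (iI b)).
move=> y _; rewrite !indicE !mem_setE !in_itv /=.
have [xay|xay] := boolP (x - a <= y <= x' - a).
  by case: (_ && _) (_ && _) (_ && _) => [] [] [];
    rewrite /= ?subrr ?subr0 ?sub0r ?normrN ?normr0 ?normr1 //; lra.
have [xby|xby] := boolP (x - b <= y <= x' - b).
  by case: (_ && _) (_ && _) => [] [];
    rewrite /= ?subrr ?subr0 ?sub0r ?normrN ?normr0 ?normr1 //; lra.
have -> : (a < x - y) = (a < x' - y).
  apply/idP/idP => [|ay]; first lra.
  by rewrite ltNge; apply: contraNN xay => ?; apply/andP; split; lra.
have -> : (x - y <= b) = (x' - y <= b); last by rewrite subrr normr0.
apply/idP/idP => [yb|]; last lra.
by rewrite leNgt; apply: contraNN xby => ?; apply/andP; split; lra.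
Qed.

(** Putting the increment on the kernel gives a constant that depends on [f]
    through its supremum alone. *)
Lemma whitham_op_indic_lipschitz f M (a b x x' : R) :
  measurable_fun setT f -> (forall y, `|f y| <= M) ->
  `|whitham_op \1_(`]a, b]%classic) f x - whitham_op \1_(`]a, b]%classic) f x'|
    <= 2 * M * `|x - x'|.
Proof.
move=> mf fM; wlog xx' : x x' / x <= x'.
  move=> H; have [xx'|/ltW x'x] := leP x x'; first exact: H.
  by rewrite distrC (distrC x); exact: H.
have iJ z := integrable_reflect z (integrable_indic_oc a b).
have iJf z := integrable_mul_bounded (iJ z) mf fM.
rewrite /whitham_op -RintegralB//.
under eq_Rintegral do rewrite -mulrBl.
apply: le_trans (le_normr_Rintegral_mul
  (integrable_diff (iJ x) (iJ x')) mf fM) _.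
have M0 : 0 <= M := le_trans (normr_ge0 _) (fM 0).
rewrite mulrAC distrC ger0_norm ?subr_ge0// ler_wpM2r//.
exact: L1norm_indic_shift.
Qed.

Lemma whitham_op_step_lipschitz s : step_fun s ->
  exists2 C, 0 <= C & forall f M, measurable_fun setT f ->
    (forall y, `|f y| <= M) -> forall x x',
    `|whitham_op s f x - whitham_op s f x'| <= C * M * `|x - x'|.
Proof.
elim=> [|c a b {}s ss [C C0 IH]].
  exists 0 => // f M _ _ x x'; rewrite !mul0r /whitham_op.
  by under eq_Rintegral do rewrite mul0r; rewrite subrr normr0.
exists (2 * `|c| + C) => [|f M mf fM x x'].
  by rewrite addr_ge0// mulr_ge0.
rewrite !(whitham_op_linear _ _ (integrable_indic_oc a b)
  (step_fun_integrable ss) mf fM).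
rewrite opprD addrACA -mulrBr (le_trans (ler_normD _ _))// normrM.
rewrite (_ : (2 * `|c| + C) * M * `|x - x'| =
  `|c| * (2 * M * `|x - x'|) + C * M * `|x - x'|); last by ring.
by rewrite lerD//; [rewrite ler_wpM2l// whitham_op_indic_lipschitz|exact: IH].
Qed.

(** The kernel is split as [(K - s) + s] with [s] a step function at L1
    distance at most [eta] from [K]: the first part contributes [eta H], and
    the second one is Lipschitz with a constant proportional to [M]. *)
Lemma whitham_op_smoothing (alpha : R) K (eta : R) : 0 < alpha <= 1 ->
  leb.-integrable setT (EFin \o K) -> 0 < eta ->
  exists2 C, 0 <= C & forall f M H, measurable_fun setT f ->
    (forall y, `|f y| <= M) ->
    (forall x y, `|f x - f y| <= H * `|x - y| `^ alpha) -> forall x x',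
    `|whitham_op K f x - whitham_op K f x'|
      <= (eta * H + C * M) * `|x - x'| `^ alpha.
Proof.
move=> /andP[alpha0 alpha1] iK eta0.
have [s ss Ks] := step_fun_dense iK eta0.
have is_ := step_fun_integrable ss.
have [C C0 sC] := whitham_op_step_lipschitz ss.
exists (C + 2 * L1norm s) => [|f M H mf fM fH x x'].
  by rewrite addr_ge0// mulr_ge0// L1norm_ge0.
have M0 : 0 <= M := le_trans (normr_ge0 _) (fM 0).
have H0 : 0 <= H.
  have := le_trans (normr_ge0 _) (fH 1 0).
  by rewrite subr0 normr1 powR1 mulr1.
have iKs := integrable_diff iK is_.
have opK z : whitham_op K f z =
    whitham_op (fun t => K t - s t) f z + whitham_op s f z.
  have := whitham_op_linear 1 z iKs is_ mf fM; rewrite mul1r => <-.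
  by congr (whitham_op _ f z); apply/funext => t; rewrite mul1r subrK.
rewrite !opK opprD addrACA (le_trans (ler_normD _ _))// mulrDl lerD//.
  rewrite -mulrA.
  apply: le_trans (whitham_op_diff_bound (B := H * `|x - x'| `^ alpha)
    iKs mf fM _) _.
    by move=> y; rewrite (le_trans (fH _ _))// opprD addrACA subrr addr0.
  by rewrite ler_wpM2r// mulr_ge0// powR_ge0.
(* A Lipschitz bound gives a Hoelder bound at distances at most [1]; beyond,
   [`|x - x'| `^ alpha >= 1] and the bound on the supremum suffices. *)
have [xx'1|xx'1] := leP `|x - x'| 1.
  apply: le_trans (sC f M mf fM x x') _.
  apply: ler_pM => //.
  - by rewrite mulr_ge0.
  - by rewrite ler_wpM2r// lerDl mulr_ge0// L1norm_ge0.
  have [->|xx'0] := eqVneq `|x - x'| 0; first exact: powR_ge0.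
  by rewrite ger1_powR// lt_neqAle eq_sym xx'0 /= normr_ge0.
apply: le_trans (ler_normB _ _) _.
apply: le_trans
  (lerD (whitham_op_bound _ is_ mf fM) (whitham_op_bound _ is_ mf fM)) _.
have H1 : 1 <= `|x - x'| `^ alpha.
  by rewrite -(powRr0 `|x - x'|) ler_powR ?ltW.
have L0 := L1norm_ge0 s.
have : 2 * L1norm s * M <= (C + 2 * L1norm s) * M.
  by rewrite ler_wpM2r// lerDr.
have : (C + 2 * L1norm s) * M <= (C + 2 * L1norm s) * M * `|x - x'| `^ alpha.
  by rewrite ler_peMr// mulr_ge0// addr_ge0// mulr_ge0.
lra.
Qed.

End smoothing.

(** * A priori bounds for solutions away from the critical height *)

Section a_priori_bound.
Context {R : realType} (alpha : R).
Local Notation leb := (@lebesgue_measure R).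
Implicit Types (f : holder_even alpha) (K : R -> R).

Lemma holder_seminormP f x y :
  `|f x - f y| <= holder_seminorm f * `|x - y| `^ alpha.
Proof.
have [->|xy] := eqVneq x y.
  by rewrite subrr normr0 mulr_ge0 ?powR_ge0 ?holder_seminorm_ge0.
rewrite -ler_pdivrMr ?holder_seminorm_ub//.
by rewrite powR_gt0// normr_gt0 subr_eq0.
Qed.

Lemma holder_even_continuous f : 0 < alpha -> continuous (f : R -> R).
Proof.
move=> alpha0 x; apply/cvgrPdist_le => e e0.
have H0 := holder_seminorm_ge0 f; set H := holder_seminorm f in H0.
have H1 : 0 < H + 1 by lra.
pose d := (e / (H + 1)) `^ alpha^-1.
have d0 : 0 < d by rewrite powR_gt0// divr_gt0.
near=> y; apply: le_trans (holder_seminormP f x y) _.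
have xyd : `|x - y| <= d.
  by near: y; exists d => //= z /ltW.
have : `|x - y| `^ alpha <= e / (H + 1).
  have -> : e / (H + 1) = d `^ alpha.
    by rewrite /d -powRrM mulVf ?gt_eqF// powRr1// divr_ge0 ?ltW.
  by apply: ge0_ler_powR; rewrite ?nnegrE //; exact: ltW.
rewrite ler_pdivlMr// -/H; have := powR_ge0 `|x - y| alpha; nra.
Unshelve. all: by end_near. Qed.

Lemma holder_even_measurable f : 0 < alpha -> measurable_fun setT (f : R -> R).
Proof.
move=> a0; apply: continuous_measurable_fun => x.
exact: holder_even_continuous.
Qed.

(** With [M] the supremum of [`|f|], the equation bounds [`|f x| ^+ 2] by
    [(1 + L1norm K) * M]; taking the supremum over [x] and dividing by [M]
    concludes. *)
Lemma whitham_solution_sup_bound K f (mu : R) : 0 < alpha -> 0 < mu < 1 ->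
  leb.-integrable setT (EFin \o K) -> whitham_solution K f mu ->
  holder_sup f <= 1 + L1norm K.
Proof.
move=> alpha0 /andP[mu0 mu1] iK sol; set M := holder_sup f.
have M0 : 0 <= M := holder_sup_ge0 f.
have L0 := L1norm_ge0 K.
have fM := holder_sup_ub f.
have f2 x : `|f x| ^+ 2 <= (1 + L1norm K) * M.
  have fE : f x ^+ 2 = mu * f x - whitham_op K f x.
    by have := sol x; rewrite /whitham_F; lra.
  rewrite -normrX fE (le_trans (ler_normB _ _))// mulrDl lerD//.
    rewrite normrM gtr0_norm// (le_trans (ler_wpM2l (ltW mu0) (fM x)))//.
    by rewrite ler_wpM2r// ltW.
  exact: (whitham_op_bound _ iK (@holder_even_measurable f alpha0) fM).
have M2 : M <= Num.sqrt ((1 + L1norm K) * M).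
  apply: holder_sup_le => x; rewrite -[leLHS]ger0_norm// -sqrtr_sqr.
  by rewrite ler_wsqrtr.
have : M ^+ 2 <= (1 + L1norm K) * M.
  rewrite -[leRHS]sqr_sqrtr ?lerXn2r ?nnegrE ?sqrtr_ge0//.
  by rewrite mulr_ge0// addr_ge0.
have [->|M_neq0] := eqVneq M 0; first by rewrite addr_ge0.
by rewrite expr2 ler_pM2r// lt_neqAle eq_sym M_neq0.
Qed.

(** The gap bounds [mu - f x - f y] below by [2 * delta], so the smoothing
    estimate with [eta = delta] yields [2 delta H <= delta H + C M] for the
    seminorm [H] and the supremum [M]; half of the left side absorbs
    [delta H]. *)
Lemma whitham_solution_norm_bound K (delta : R) : 0 < alpha <= 1 ->
  leb.-integrable setT (EFin \o K) -> 0 < delta ->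
  exists B, forall f (mu : R), 0 < mu < 1 -> whitham_solution K f mu ->
    (forall x, delta <= mu / 2 - f x) -> holder_norm f <= B.
Proof.
move=> alpha01 iK delta0; have /andP[alpha0 _] := alpha01.
have [C C0 smoothK] := whitham_op_smoothing alpha01 iK delta0.
exists ((1 + L1norm K) + C * (1 + L1norm K) / delta) => f mu mu01 sol gap.
have fsup := whitham_solution_sup_bound alpha0 mu01 iK sol.
rewrite /holder_norm lerD//.
set H := holder_seminorm f; set M := holder_sup f in fsup.
suff : H <= (delta * H + C * M) / (2 * delta).
  rewrite ler_pdivlMr ?mulr_gt0// => HM.
  rewrite ler_pdivlMr//; apply: (@le_trans _ _ (C * M)); first lra.
  by rewrite ler_wpM2l.
apply: holder_seminorm_le => x y xy.
have xy0 : 0 < `|x - y| `^ alpha by rewrite powR_gt0// normr_gt0 subr_eq0.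
rewrite ler_pdivrMr// mulrAC ler_pdivlMr ?mulr_gt0//.
have := smoothK f M H (@holder_even_measurable f alpha0)
  (holder_sup_ub f) (@holder_seminormP f) x y.
apply: le_trans.
have -> : whitham_op K f x - whitham_op K f y =
    (f x - f y) * (mu - f x - f y).
  have := sol x; have := sol y; rewrite /whitham_F => sy sx.
  suff : whitham_op K f x = mu * f x - f x ^+ 2 /\
         whitham_op K f y = mu * f y - f y ^+ 2 by case=> -> ->; ring.
  by split; lra.
rewrite normrM ler_wpM2l//; apply: le_trans (ler_norm _).
by have := gap x; have := gap y; lra.
Qed.

End a_priori_bound.

(** * Distance to the boundary of U *)

Section boundary.
Context {R : realType} (alpha : R).
Implicit Types (f : holder_even alpha) (c mu r : R).

Lemma holder_cst_subproof c : (fun=> c) \in @holder_even_pred R alpha.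
Proof.
rewrite inE; split=> //; first by exists `|c|.
by exists 0 => x y; rewrite subrr normr0 mul0r.
Qed.

Definition holder_cst c : holder_even alpha :=
  HolderEven (holder_cst_subproof c).

Lemma holder_cst_norm c : holder_norm (holder_cst c) <= `|c|.
Proof.
rewrite /holder_norm -[leRHS]addr0 lerD//; first exact: holder_sup_le.
by apply: holder_seminorm_le => x y _; rewrite subrr normr0 mul0r.
Qed.

Lemma ball_holder_shift f mu c c' r : `|c - c'| < r ->
  ball ((f + holder_cst c, mu) : holder_even alpha * R) r
    (f + holder_cst c', mu).
Proof.
move=> ccr; split => /=; last by apply: ballxx; exact: le_lt_trans ccr.
rewrite -ball_normE /ball_ /= opprD addrACA subrr add0r.
apply: le_lt_trans ccr.
have -> : holder_cst c - holder_cst c' = holder_cst (c - c').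
  exact/val_inj.
exact: holder_cst_norm.
Qed.

(** With [m] the infimum of [mu / 2 - f], the point [(f + m, mu)] is in the
    boundary: shifting it slightly down gives points of [U], shifting it
    slightly up makes it exceed [mu / 2] somewhere. *)
Lemma edist_boundary_whitham_U f mu r :
  whitham_U alpha (f, mu) -> (exists x, mu / 2 - f x < r) ->
  (edist_inf (boundary (whitham_U alpha)) ((f, mu) : holder_even alpha * R)
    <= r%:E)%E.
Proof.
move=> [/= mu01 fmu] [x0 x0r].
pose A := [set mu / 2 - f x | x in setT]; pose m := inf A.
have A0 : A !=set0 by exists (mu / 2 - f x0); exists x0.
have lA : lbound A 0 by move=> _ [x _ <-]; rewrite subr_ge0 ltW.
have mA x : m <= mu / 2 - f x.
  by apply: ge_inf; [exists 0|exists x].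
have m0 : 0 <= m by apply: lb_le_inf.
have mr : m < r := le_lt_trans (mA x0) x0r.
have f0 : (f, mu) = (f + holder_cst 0, mu).
  by congr (_, _); apply/val_inj/funext => x /=; rewrite fctE/= addr0.
apply: (@le_trans _ _
  (edist ((f, mu) : holder_even alpha * R, (f + holder_cst m, mu)))).
  apply: ereal_inf_lbound; exists (f + holder_cst m, mu) => //; split.
    move=> B /nbhs_ballP[e /= e0 eB]; exists (f + holder_cst (m - e / 2), mu).
    split; last first.
      apply: eB; apply: ball_holder_shift.
      by rewrite opprB addrC subrK ger0_norm; lra.
    split => //= x; rewrite fctE /=; have := mA x; lra.
  move=> /nbhs_ballP[e /= e0 eU].
  have [|_ /= mU] := eU (f + holder_cst (m + e / 2), mu).
    apply: ball_holder_shift.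
    by rewrite opprD addrA subrr sub0r normrN ger0_norm; lra.
  have : m + e / 2 <= m.
    apply: lb_le_inf => // _ [x _ <-].
    by have := mU x; rewrite fctE /=; lra.
  lra.
apply: edist_fin; first exact: le_lt_trans mr.
by rewrite /= {1}f0; apply: ball_holder_shift; rewrite sub0r normrN ger0_norm.
Qed.

End boundary.

(** * Conclusion *)

Lemma limf_einf_pinfty_eq0 (R : realType) (F : R -> \bar R) :
  (forall e, 0 <= e -> (0 <= F e)%E) ->
  (forall (A : set R) r, (\forall e \near +oo, A e) -> 0 < r ->
    exists2 e, A e & (F e <= r%:E)%E) ->
  limf_einf F (+oo) = 0%E.
Proof.
move=> F0 Fr; rewrite limf_einfE; apply/eqP; rewrite eq_le; apply/andP; split.
  apply: ge_ereal_sup => _ [V oV <-]; apply/lee_addgt0Pr => r r0.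
  have [e Ve Fe] := Fr V r oV r0; rewrite add0e.
  by apply: le_trans Fe; apply: ereal_inf_lbound; exists e.
apply: (@le_trans _ _ (ereal_inf (F @` [set e | 0 <= e]))).
  by apply: le_ereal_inf_tmp => _ [e e0 <-]; exact: F0.
apply: ereal_sup_ubound; exists [set e | 0 <= e] => //.
exact: nbhs_pinfty_ge.
Qed.

Theorem proposition4p9 (R : realType) (alpha : R) (K : R -> R)
    (phi : R -> holder_even alpha) (mu : R -> R) :
  2^-1 < alpha < 1 ->
  is_whitham_kernel K ->
  global_bifurcation_curve K phi mu ->
  (~ bounded_near phi (+oo) ->
     limf_einf (fun e => ereal_inf [set (mu e / 2 - phi e x)%:E | x in setT])
       (+oo) = 0%E)
  /\
  (~ bounded_near phi (+oo) ->
     limf_einf (fun e => edist_inf (boundary (whitham_U alpha))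
                           (phi e, mu e)) (+oo) = 0%E).
Proof.
move=> /andP[alpha12 alpha1] [iK _ _] [_ phiS _].
have alpha01 : 0 < alpha <= 1 by apply/andP; split; lra.
(* Both claims follow from the same fact: the gap is arbitrarily small at
   arbitrarily large parameters. *)
suff gap : ~ bounded_near phi (+oo) -> forall (A : set R) r,
    (\forall e \near +oo, A e) -> 0 < r ->
    exists e, [/\ A e, 0 <= e & exists x, mu e / 2 - phi e x < r].
  split=> unb; apply: limf_einf_pinfty_eq0.
  - move=> e /phiS[[_ phi_lt] _]; apply: le_ereal_inf_tmp => _ [x _ <-].
    by rewrite lee_fin subr_ge0 ltW// phi_lt.
  - move=> A r oA r0; have [e [Ae _ [x xr]]] := gap unb A r oA r0.
    exists e => //; apply: (@le_trans _ _ (mu e / 2 - phi e x)%:E).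
      by apply: ereal_inf_lbound; exists x.
    by rewrite lee_fin ltW.
  - by move=> e _; exact: edist_inf_ge0.
  - move=> A r oA r0; have [e [Ae e0 xr]] := gap unb A r oA r0.
    exists e => //; apply: edist_boundary_whitham_U => //.
    by have [] := phiS e e0.
move=> unb A r oA r0; apply: contrapT => nogap; apply: unb.
have [B solB] := whitham_solution_norm_bound alpha01 iK r0.
apply/ex_bound; exists B; near=> e => /=.
have e0 : 0 <= e by near: e; exact: nbhs_pinfty_ge.
have [[mu01 _] sol] := phiS e e0.
apply: solB mu01 sol _ => x; rewrite leNgt; apply/negP => xr.
apply: nogap; exists e; split => //; last by exists x.
by near: e.
Unshelve. all: by end_near. Qed.
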